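(* Fix an integer $n\geq 1$ and let $G=\mathrm{Gal}(\mathbb{Q}(X_{n-1})/\mathbb{Q})$. For each $s=(s_\sigma)_{\sigma\in G}\in\{1,-1\}^{G}$ choose $a_s\in\mathbb{Z}[X_{n-1}]$ with $\|\mu_s(X_n)-\mu(a_s)\|=\min\{\|\mu_s(X_n)-\mu(a)\|: a\in\mathbb{Z}[X_{n-1}]\}$, and for $\sigma\in G$ set $$b_{s,\sigma}=\frac{|\sigma(X_n)+1|}{|s_\sigma\sigma(X_n)-\sigma(a_s)|},\qquad C_{s,\sigma}=\log\left(\sqrt{b_{s,\sigma}^2+1}+|b_{s,\sigma}|\right).$$ If $\varepsilon\in RE_n^-$ satisfies $p(\varepsilon)\mid q(\varepsilon)-1$ and $p(\varepsilon)\mid X_n^2q(\varepsilon)-1$ in $\mathbb{Z}[X_{n-1}]$ and $p(\varepsilon)q(\varepsilon)>0$, then there exists $\sigma\in G$ such that $\bigl|\log|\sigma(\varepsilon)|\bigr|\leq C_{s,\sigma}$, where $s=(\mathrm{sgn}(\sigma(p(\varepsilon)q(\varepsilon))))_{\sigma\in G}$.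
   Context: For $m\geq 0$ let $X_m=2\cos(2\pi/2^{m+2})$ (so $X_0=0$ and $X_m=\sqrt{2+X_{m-1}}$), viewed as real numbers; $\mathbb{Z}[X_m]$ is the ring of integers of the totally real field $\mathbb{Q}(X_m)$, and $\mathrm{Gal}(\mathbb{Q}(X_{n-1})/\mathbb{Q})$ has order $2^{n-1}$. Every $x\in\mathbb{Z}[X_n]$ can be written uniquely as $x=p(x)+X_nq(x)$ with $p(x),q(x)\in\mathbb{Z}[X_{n-1}]$; $RE_n^-=\{\varepsilon\in\mathbb{Z}[X_n]: p(\varepsilon)^2-X_n^2q(\varepsilon)^2=-1\}$. Each $\sigma\in\mathrm{Gal}(\mathbb{Q}(X_{n-1})/\mathbb{Q})$, viewed as a real embedding, is extended to $\mathbb{Q}(X_n)$ by setting $\sigma(X_n)=\sqrt{2+\sigma(X_{n-1})}>0$; thus $\sigma(\varepsilon)=\sigma(p(\varepsilon))+\sigma(X_n)\sigma(q(\varepsilon))$. Define $\mu:\mathbb{Q}(X_{n-1})\to\mathbb{R}^{G}$ by $\mu(x)=(\sigma(x))_{\sigma\in G}$ and, for $s\in\{1,-1\}^G$, $\mu_s(X_n)=(s_\sigma\sigma(X_n))_{\sigma\in G}\in\mathbb{R}^G$; $\|\cdot\|$ is the Euclidean norm on $\mathbb{R}^G$. *)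

(* Defs.v *)
From HB Require Import structures.
From mathcomp Require Export all_boot all_order all_algebra all_fingroup all_field.
From mathcomp Require Export all_classical all_reals all_analysis.
From mathcomp Require Import ring lra zify.

Set Implicit Arguments.
Unset Strict Implicit.
Unset Printing Implicit Defensive.

Import Order.TTheory GRing.Theory Num.Theory.

Local Open Scope classical_set_scope.
Local Open Scope ring_scope.

Definition X (R : realType) (m : nat) : R := 2 * cos (2 * pi / 2 ^+ (m + 2)).

Definition adjZ (A : comNzRingType) (z : A) : set A :=
  [set (map_poly intr f).[z] | f in [set: {poly int}]].

(* Q(X_m) is handled as an abstract Galois extension of rat together with an
   embedding into R whose image is the real subfield Q(X_m): the library's
   Galois groups are only available for a splittingFieldType. Such a field
   exists (QX_inhabited). An element y is read as the real number emb y. *)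
Record QX (R : realType) (m : nat) := MkQX {
  QX_field :> splittingFieldType rat;
  emb : {rmorphism QX_field -> R};
  gen : QX_field;
  emb_gen : emb gen = X R m;
  gen_full : <<1; gen>>%VS = {: QX_field}%VS }.

Arguments emb {R m} K : rename.
Arguments gen {R m} K : rename.

Definition GalQ (R : realType) (m : nat) (K : QX R m) := gal_of {: K}%VS.

Definition enorm (R : realType) (I : finType) (u : {ffun I -> R}) : R :=
  Num.sqrt (\sum_i u i ^+ 2).

Section Pell.
Context {R : realType} {n : nat} (K : QX R n.-1).

Definition ZX : set K := adjZ (gen K).

(* (p(eps), q(eps)); see pqP and pq_unique *)
Definition pq (eps : R) : K * K :=
  xget (0, 0) [set ab | [/\ ZX ab.1, ZX ab.2 &
                            eps = emb K ab.1 + X R n * emb K ab.2]].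
Definition pcoord (eps : R) : K := (pq eps).1.
Definition qcoord (eps : R) : K := (pq eps).2.

Definition RE_minus : set R :=
  [set eps | adjZ (X R n) eps /\
             emb K (pcoord eps) ^+ 2 - X R n ^+ 2 * emb K (qcoord eps) ^+ 2 = -1].

(* divisibility in Z[X_{n-1}], for elements given as real numbers *)
Definition dvdZX (u v : R) : Prop := exists2 c : K, ZX c & v = u * emb K c.

Definition gal_emb (g : GalQ K) (y : K) : R := emb K (g y).

Definition gal_X (g : GalQ K) : R := Num.sqrt (2 + gal_emb g (gen K)).

Definition gal_ext (g : GalQ K) (eps : R) : R :=
  gal_emb g (pcoord eps) + gal_X g * gal_emb g (qcoord eps).

Definition mu (y : K) : {ffun GalQ K -> R} := [ffun g => gal_emb g y].

Definition mu_X (s : {ffun GalQ K -> R}) : {ffun GalQ K -> R} :=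
  [ffun g => s g * gal_X g].

Definition is_sign (s : {ffun GalQ K -> R}) : Prop :=
  forall g, s g = 1 \/ s g = -1.

Definition closest (s : {ffun GalQ K -> R}) (y : K) : Prop :=
  ZX y /\ forall z : K, ZX z -> enorm (mu_X s - mu y) <= enorm (mu_X s - mu z).

Definition b_const (a : {ffun GalQ K -> R} -> K) (s : {ffun GalQ K -> R}) (g : GalQ K)
    : R :=
  `|gal_X g + 1| / `|s g * gal_X g - gal_emb g (a s)|.

Definition C_const (a : {ffun GalQ K -> R} -> K) (s : {ffun GalQ K -> R}) (g : GalQ K)
    : R :=
  ln (Num.sqrt (b_const a s g ^+ 2 + 1) + `|b_const a s g|).

End Pell.

(* The remainder proves that pcoord, qcoord are well defined (pqP, pq_unique) and that
   QX R m is inhabited (QX_inhabited). *)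
Section WellDefined.
Context {R : realType}.

Lemma X0 : X R 0 = 0.
Proof.
rewrite /X add0n (_ : 2 * pi / 2 ^+ 2 = pi / 2 :> R); last by field.
by rewrite cos_pihalf mulr0.
Qed.

Lemma XS m : X R m.+1 ^+ 2 = 2 + X R m.
Proof.
rewrite /X addSn; set t := 2 * pi / 2 ^+ (m + 2).+1.
rewrite (_ : 2 * pi / 2 ^+ (m + 2) = t *+ 2); last first.
  have e0 : (2 : R) ^+ (m + 2) != 0 by rewrite expf_neq0 // pnatr_eq0.
  by rewrite /t exprS mulr2n; field.
by rewrite cos_mulr2n mulr2n; ring.
Qed.

Let lc (x y u v : R) : u = v -> x - y = u - v -> x = y.
Proof. by move=> -> /eqP; rewrite subrr subr_eq0 => /eqP. Qed.

Local Opaque X.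

Lemma horner_split (A : comNzRingType) (h : {rmorphism A -> R}) m (f : {poly A}) :
  exists u v : {poly A}, (map_poly h f).[X R m.+1] =
     (map_poly h u).[X R m] + (map_poly h v).[X R m] * X R m.+1.
Proof.
have := XS m; move: (X R m.+1) (X R m) => y x yE.
elim/poly_ind: f => [|f c [u [v IH]]].
  by exists 0, 0; rewrite !rmorph0 !horner0 mul0r addr0.
exists (v * ('X + 2%:P) + c%:P), u.
rewrite !(rmorphD, rmorphM) /= !map_polyX !map_polyC /= !hornerE.
rewrite IH ?rmorphD ?rmorph1.
apply: (lc (congr1 (fun z => (map_poly h v).[x] * z) yE)) => /=; ring.
Qed.

Let ev m (f : {poly rat}) := (map_poly ratr f).[X R m].
Let evB m f g : ev m (f - g) = ev m f - ev m g.
Proof. by rewrite /ev rmorphB !hornerE. Qed.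
Let evD m f g : ev m (f + g) = ev m f + ev m g.
Proof. by rewrite /ev rmorphD !hornerE. Qed.
Let evM m f g : ev m (f * g) = ev m f * ev m g.
Proof. by rewrite /ev rmorphM !hornerE. Qed.
Let evC m c : ev m c%:P = ratr c.
Proof. by rewrite /ev map_polyC !hornerE. Qed.
Let evX m : ev m 'X = X R m.
Proof. by rewrite /ev map_polyX !hornerE. Qed.

Lemma rat_sqrt2 (a c : rat) : a ^+ 2 = c ^+ 2 * 2 -> c = 0.
Proof.
move=> H; apply/eqP; apply: contraT => c0.
have {}H : (a / c) ^+ 2 = 2 by rewrite expr_div_n H; field.
have [p' [q' [q0 Epq cop]]] : exists p' q' : nat, [/\ (0 < q')%N, `|a / c| = p'%:R / q'%:R & coprime p' q'].
  case: (ratP `|a / c|) (normr_ge0 (a / c)) => k d cop; case: k cop => k cop; last first.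
    rewrite pmulr_lge0 ?invr_gt0 ?ltr0n // NegzE mulrNz oppr_ge0.
    by rewrite -[_%:~R]/(k.+1%:R) lern0.
  by exists k, d.+1.
have {}H : (p' ^ 2 = 2 * q' ^ 2)%N.
  have: `|a / c| ^+ 2 = 2 by rewrite real_normK ?num_real.
  rewrite Epq expr_div_n => /(canRL (divfK _)) H2.
  have {}H2 := H2 (expf_neq0 _ (lt0r_neq0 _)).
  apply/eqP; rewrite -(eqr_nat rat) natrX natrM natrX H2 // ltr0n //.
have dp : (2 %| p')%N.
  have : (2 %| p' ^ 2)%N by rewrite H dvdn_mulr.
  by rewrite Euclid_dvdX // andbT.
have dq : (2 %| q')%N.
  case/dvdnP: dp H => k ->; rewrite expnMn => H.
  have {}H : (q' ^ 2 = 2 * k ^ 2)%N by lia.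
  have : (2 %| q' ^ 2)%N by rewrite H dvdn_mulr.
  by rewrite Euclid_dvdX // andbT.
by have := coprime_dvdl dp (coprime_dvdr dq cop).
Qed.

Lemma no_square m (e : bool) (f g : {poly rat}) :
  ev m f ^+ 2 = ev m g ^+ 2 * (2 + (-1) ^+ e * X R m) -> ev m g = 0.
Proof.
elim: m e f g => [|m IH] e f g.
  rewrite /ev X0 !horner_coef0 !coef_map /= mulr0 addr0.
  rewrite -(rmorph_nat (@ratr R) 2) -!rmorphXn -rmorphM => /fmorph_inj.
  by move=> /rat_sqrt2 ->; rewrite rmorph0.
have indep u v : ev m u + ev m v * X R m.+1 = 0 -> ev m u = 0 /\ ev m v = 0.
  move=> H; have v0 : ev m v = 0.
    apply: (IH false u); rewrite expr0 mul1r -XS.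
    by rewrite (_ : ev m u = - (ev m v * X R m.+1)) ?sqrrN ?exprMn //; apply/eqP; rewrite -addr_eq0 H.
  by move: H; rewrite v0 mul0r addr0.
have [a0 [a1 Ea]] := horner_split (@ratr R) m f.
have [b0 [b1 Eb]] := horner_split (@ratr R) m g.
have {}Ea : ev m.+1 f = ev m a0 + ev m a1 * X R m.+1 by [].
have {}Eb : ev m.+1 g = ev m b0 + ev m b1 * X R m.+1 by [].
rewrite Ea Eb => H.
have [s Es] : exists s, ev m s = (-1) ^+ e.
  by exists ((-1) ^+ e)%:P; rewrite evC rmorphXn rmorphN1.
have [Y EY] : exists Y, ev m Y = X R m.+1 ^+ 2.
  by exists ('X + 2%:P); rewrite evD evX evC ?rmorphD ?rmorph1 XS addrC.
have [d E2] : exists d, ev m d = 2.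
  by exists 2%:P; rewrite evC ?rmorphD ?rmorph1.
have s2 : ((-1) ^+ e) ^+ 2 = 1 :> R by rewrite sqrr_sign.
pose t := a0 * a0 + a1 * a1 * Y - d * (b0 * b0 + b1 * b1 * Y) - s * d * b0 * b1 * Y.
pose w := d * a0 * a1 - s * (b0 * b0 + b1 * b1 * Y) - d * d * b0 * b1.
have [] := indep t w.
  rewrite /t /w !(evB, evD, evM) Es EY E2.
  by apply: (lc H); ring.
rewrite /t /w !(evB, evD, evM) Es EY E2 => Ht Hw.
have Hconj : (ev m a0 - ev m a1 * X R m.+1) ^+ 2 =
   (ev m b0 - ev m b1 * X R m.+1) ^+ 2 * (2 - (-1) ^+ e * X R m.+1).
  apply: (lc (congr2 (fun x y => x - X R m.+1 * y) Ht Hw)) => /=; ring.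
have N0 : ev m (b0 * b0 - b1 * b1 * Y) = 0.
  apply: (IH true (a0 * a0 - a1 * a1 * Y)).
  rewrite !(evB, evM) EY expr1 mulN1r.
  have -> : 2 - X R m = (2 + (-1) ^+ e * X R m.+1) * (2 - (-1) ^+ e * X R m.+1).
    by ring: s2 (XS m).
  transitivity ((ev m a0 + ev m a1 * X R m.+1) ^+ 2 * (ev m a0 - ev m a1 * X R m.+1) ^+ 2); first by ring.
  by rewrite H Hconj; ring.
have b10 : ev m b1 = 0.
  apply: (IH false b0); rewrite expr0 mul1r -XS -EY.
  by move: N0; rewrite !(evB, evM) => /eqP; rewrite subr_eq0 => /eqP N0; rewrite !expr2 N0.
move: N0; rewrite !(evB, evM) b10 !mul0r subr0 => /eqP.
by rewrite mulf_eq0 orbb => /eqP ->; rewrite addr0.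
Qed.

Lemma ZX_emb n (K : QX R n.-1) (y : K) : ZX y ->
  exists f : {poly rat}, emb K y = ev n.-1 f.
Proof.
case=> f _ <-; exists (map_poly intr f).
rewrite -horner_map emb_gen /ev -!map_poly_comp /=; congr _.[_].
by apply: eq_map_poly => c /=; rewrite !rmorph_int.
Qed.

Lemma pq_unique n (K : QX R n.-1) (a b a' b' : K) : (0 < n)%N ->
  ZX a -> ZX b -> ZX a' -> ZX b' ->
  emb K a + X R n * emb K b = emb K a' + X R n * emb K b' -> a = a' /\ b = b'.
Proof.
case: n K a b a' b' => // n K a b a' b' _.
move=> /ZX_emb[/= fa Ea] /ZX_emb[/= fb Eb] /ZX_emb[/= fa' Ea'] /ZX_emb[/= fb' Eb'] H.
have bb' : emb K b = emb K b'.
  apply/eqP; rewrite -subr_eq0 Eb Eb' -evB; apply/eqP.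
  apply: (@no_square n false (fa' - fa)).
  rewrite !evB -Ea -Ea' -Eb -Eb' expr0 mul1r -XS -exprMn; congr (_ ^+ 2).
  by apply: (lc (esym H)); ring.
split; apply: (fmorph_inj (emb K)) => //.
by move: H; rewrite bb' => /addIr.
Qed.

Lemma pqP n (K : QX R n.-1) eps : (0 < n)%N -> adjZ (X R n) eps ->
  [/\ ZX (pcoord K eps), ZX (qcoord K eps) &
      eps = emb K (pcoord K eps) + X R n * emb K (qcoord K eps)].
Proof.
case: n K eps => // n K eps _ [f _ fE].
rewrite /pcoord /qcoord /pq; case: xgetP => [ab _ //|/=].
have [u [v E]] := horner_split intr n f.
case/(_ ((map_poly intr u).[gen K], (map_poly intr v).[gen K])).
have emE (h : {poly int}) : emb K (map_poly intr h).[gen K] = (map_poly intr h).[X R n].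
  rewrite -horner_map emb_gen -map_poly_comp /=; congr _.[_].
  by apply: eq_map_poly => c /=; rewrite rmorph_int.
by split=> /=; [exists u|exists v|rewrite -fE E !emE mulrC].
Qed.


(* 2 cos (k t) as a polynomial in 2 cos t *)
Fixpoint cheb (A : comNzRingType) (z : A) (k : nat) : A * A :=
  if k is k'.+1 then let: (u, v) := cheb z k' in (v, z * v - u) else (2, z).

Lemma chebE (t : R) k :
  cheb (2 * cos t) k = (2 * cos (t *+ k), 2 * cos (t *+ k.+1)).
Proof.
elim: k => [|k IH] /=; first by rewrite mulr0n cos0 mulr1.
rewrite IH; congr pair; rewrite (mulrS t k.+1) (mulrS t k) !cosD sinD.
have := cos2Dsin2 t; move: (cos t) (sin t) (cos (t *+ k)) (sin (t *+ k)).
move=> c s u v H; apply: (lc (congr1 (fun z => 2 * u * z) H)) => /=; ring.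
Qed.

Lemma cheb_rmorph (A : comNzRingType) (h : {rmorphism A -> R}) z k :
  cheb (h z) k = (h (cheb z k).1, h (cheb z k).2).
Proof.
elim: k => [|k IH] /=; first by rewrite rmorph_nat.
by rewrite IH; case: (cheb z k) => u v /=; rewrite rmorphB rmorphM.
Qed.

Fixpoint Psi m : {poly rat} :=
  if m is m'.+1 then Psi m' \Po ('X ^+ 2 - 2%:P) else 'X.

Lemma size_Psi m : size (Psi m) = (2 ^ m).+1.
Proof.
elim: m => [|m IH] /=; first by rewrite size_polyX.
have s3 : size ('X ^+ 2 - 2%:P : {poly rat}) = 3%N by rewrite size_XnsubC.
have := size_comp_poly (Psi m) ('X ^+ 2 - 2%:P).
rewrite s3 IH /= expnSr => <-; rewrite prednK // size_poly_gt0.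
by rewrite comp_poly_eq0 ?s3 // -size_poly_gt0 IH.
Qed.

Lemma Psi_cos (t : R) m :
  (map_poly ratr (Psi m)).[2 * cos t] = 2 * cos (t *+ 2 ^ m).
Proof.
elim: m t => [|m IH] t /=; first by rewrite map_polyX hornerX mulr1n.
rewrite map_comp_poly horner_comp rmorphB /= map_polyXn map_polyC /= !hornerE.
rewrite rmorph_nat expnS mulrnA -IH; congr _.[_].
by rewrite cos_mulr2n; ring.
Qed.

Definition theta m : R := 2 * pi / 2 ^+ (m + 2).

Lemma theta_mul m k : theta m *+ (2 ^ m * k) = k%:R * (pi / 2).
Proof.
have e0 : (2 : R) ^+ m != 0 by rewrite expf_neq0 // pnatr_eq0.
rewrite -[_ *+ (2 ^ m * k)]mulr_natl natrM natrX /theta exprD; field.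
by [].
Qed.

Lemma cos_odd_pihalf k : cos (k.*2.+1%:R * (pi / 2)) = 0 :> R.
Proof.
elim: k => [|k IH]; first by rewrite mul1r cos_pihalf.
rewrite doubleS -[_.+3]addn2 natrD mulrDl cosD IH mul0r.
rewrite (_ : 2 * (pi / 2) = pi); last by field.
by rewrite sinpi mulr0 subrr.
Qed.

Lemma Psi_root m k :
  root (map_poly ratr (Psi m)) (2 * cos (theta m *+ k.*2.+1)).
Proof.
by rewrite rootE Psi_cos -mulrnA mulnC theta_mul cos_odd_pihalf mulr0.
Qed.

Lemma cos_theta_inj m k l : (k < 2 ^ m)%N -> (l < 2 ^ m)%N ->
  2 * cos (theta m *+ k.*2.+1) = 2 * cos (theta m *+ l.*2.+1) :> R -> k = l.
Proof.
have th0 : 0 < theta m by rewrite /theta divr_gt0 ?mulr_gt0 ?pi_gt0 ?exprn_gt0.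
have inpi i : (i < 2 ^ m)%N -> theta m *+ i.*2.+1 \in `[0, pi].
  move=> li; rewrite in_itv /= mulrn_wge0 ?(ltW th0) //=.
  have -> : pi = theta m *+ (2 ^ m * 2) by rewrite theta_mul; field.
  by rewrite ler_pMn2l //; lia.
move=> lk ll /(mulfI _)H; apply: double_inj; apply: succn_inj.
have /(cos_inj (inpi _ lk) (inpi _ ll)) : cos (theta m *+ k.*2.+1) = cos (theta m *+ l.*2.+1).
  by apply: H; rewrite pnatr_eq0.
by move/(mulrIn (lt0r_neq0 th0)).
Qed.

Lemma QX_inhabited m : inhabited (QX R m).
Proof.
have XE : X R m = 2 * cos (theta m *+ 1) by [].
have Psi0 : Psi m != 0 by rewrite -size_poly_eq0 size_Psi.
have rPsi : root (map_poly ratr (Psi m)) (X R m) by rewrite XE (Psi_root m 0).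
pose good k := `[< exists f : {poly rat},
   [/\ f != 0, root (map_poly ratr f) (X R m) & size f = k] >].
have exk : exists k, good k by exists (size (Psi m)); apply/asboolP; exists (Psi m).
have := ex_minnP exk; case=> d /asboolP[f [f0 rf <-]] fmin.
have irr : irreducible_poly f.
  apply/(subfx_irreducibleP rf f0) => g rg g0.
  by apply: fmin; apply/asboolP; exists g.
pose L := SubFieldExtType rf irr.
pose h : {rmorphism L -> R} := subfx_inj.
pose x : L := subfx_root (@ratr R) (X R m) f.
have hx : h x = X R m by apply: subfx_inj_root.
have xfull : <<1; x>>%VS = fullv :> {vspace L}.
  apply/vspaceP => y; rewrite memvf.
  have [g ->] := subfxEroot rf f0 y.
  by apply/Fadjoin_polyP; eexists; [apply: alg_polyOver|].
pose y k : L := (cheb x k.*2.+1).1.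
have hy k : h (y k) = 2 * cos (theta m *+ k.*2.+1).
  have := cheb_rmorph h x k.*2.+1; rewrite hx XE mulr1n chebE.
  by case=> ->.
pose rs := [seq y k | k <- iota 0 (2 ^ m)].
pose P := map_poly (in_alg L) (Psi m).
have PE : map_poly h P = map_poly ratr (Psi m).
  by rewrite -map_poly_comp; apply: eq_map_poly => c /=; apply: subfx_inj_base.
have split : SplittingField.axiom L.
  exists P; first exact: alg_polyOver.
  exists rs.
    rewrite (@all_roots_prod_XsubC _ P rs).
    - by rewrite eqp_scale // lead_coef_eq0 map_poly_eq0.
    - by rewrite size_map_poly size_Psi size_map size_iota.
    - apply/allP => _ /mapP[k _ ->].
      by rewrite -(fmorph_root h) PE hy Psi_root.
    - rewrite uniq_rootsE map_inj_in_uniq ?iota_uniq // => k l.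
      rewrite !mem_iota !add0n /= => lk ll /(congr1 h).
      by rewrite !hy => /cos_theta_inj ->.
  apply/eqP; rewrite eqEsubv subvf /= -xfull.
  apply/FadjoinP; split; first exact: subv_adjoin_seq.
  apply: seqv_sub_adjoin; apply/mapP; exists 0%N => //.
  by rewrite mem_iota /= expn_gt0.
pose L' : splittingFieldType rat :=
  HB.pack L (FieldExt_isSplittingField.Build rat L split).
by constructor; exists L' h x.
Qed.

End WellDefined.

(* Main.v *)
(** Write [P], [Q], [X] for the images of p(eps), q(eps), X_n under an embedding
    sigma.  Since [P^2 - X^2 Q^2 = -1], [|log |sigma eps||] is [arcsinh |P|], so one has
    to find sigma with [|P| |s X - a_s| <= X + 1].  The quotient [c = (X^2 Q - 1) / P] lies
    in Z[X_{n-1}] and [P (s X - c) = X (s P - X Q) + 1], where [|s P - X Q| <= 1] because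
    [s P] and [X Q] have the same sign; hence [c] satisfies this bound at every sigma.
    As [a_s] is at least as close to [s X_n] as [c], it is so in some coordinate. *)
Require Import Defs.
From mathcomp Require Import ring lra.

Import Order.TTheory GRing.Theory Num.Theory.

Local Open Scope ring_scope.

(** Since [|v| + |u|] and [|v| - |u|] have product 1, [|u + v|] is [|v| + |u|] or its inverse
    according to the signs, and the two logarithms differ only in sign. *)
Lemma ln_norm_unit (R : realType) (u v : R) : v ^+ 2 = u ^+ 2 + 1 ->
  `| ln `|u + v| | = ln (Num.sqrt (u ^+ 2 + 1) + `|u|).
Proof.
move=> vE; rewrite -vE sqrtr_sqr.
have Nu : `|u| ^+ 2 = u ^+ 2 by rewrite real_normK ?num_real.
have Nv : `|v| ^+ 2 = v ^+ 2 by rewrite real_normK ?num_real.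
have u0 := normr_ge0 u; have v0 := normr_ge0 v.
have w1 : 1 <= `|v| + `|u| by nra.
have lw : 0 <= ln (`|v| + `|u|) by rewrite ln_ge0.
have w0 : 0 < `|v| + `|u| by lra.
have [->|->] : `|u + v| = `|v| + `|u| \/ `|u + v| = (`|v| + `|u|)^-1.
- have -> : (`|v| + `|u|)^-1 = `|v| - `|u|.
    apply: (mulfI (lt0r_neq0 w0)); rewrite divff ?lt0r_neq0 //; nra.
  by case: (ger0P u) Nu u0 w0 w1 => ?; case: (ger0P v) Nv v0 => ?;
     case: (ger0P (u + v)) => ? *; (left + right); nra.
- by rewrite ger0_norm.
- by rewrite lnV ?posrE // normrN ger0_norm.
Qed.

Lemma quotient_near_sqrt (R : realType) (x p q c : R) : 0 <= x ->
  p ^+ 2 - x ^+ 2 * q ^+ 2 = -1 -> x ^+ 2 * q - 1 = p * c ->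
  `|p| * `|Num.sg (p * q) * x - c| <= x + 1.
Proof.
move=> x0 pell cE; rewrite sgrM -normrM.
have -> : p * (Num.sg p * Num.sg q * x - c) = x * (Num.sg q * `|p| - x * q) + 1.
  by rewrite [`|p|]normrEsg mulrBr -cE; ring.
(* By [pell], [x * |q|] is the square root of [|p| ^+ 2 + 1], hence within 1 of [|p|]; the factor
   [Num.sg q] aligns the two signs. *)
suff h : `|Num.sg q * `|p| - x * q| <= 1.
  by rewrite (le_trans (ler_normD _ _)) // normr1 lerD2r normrM ger0_norm // ler_piMr.
have Np : `|p| ^+ 2 = p ^+ 2 by rewrite real_normK ?num_real.
have p0 := normr_ge0 p.
have xq : (x * `|q|) ^+ 2 = `|p| ^+ 2 + 1.
  by rewrite exprMn real_normK ?num_real // Np; lra.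
have xq0 : 0 <= x * `|q| by rewrite mulr_ge0.
have [q0|q0|q0] := ltrgt0P q.
- rewrite gtr0_sg // mul1r ler_norml; move: xq xq0; rewrite gtr0_norm // => *.
  by apply/andP; split; nra.
- rewrite ltr0_sg // mulN1r ler_norml; move: xq xq0; rewrite ltr0_norm // mulrN => *.
  by apply/andP; split; nra.
- by rewrite q0 sgr0 mul0r mulr0 subrr normr0.
Qed.

(** Otherwise the sums of squares would compare strictly the other way; [i0] makes the index set
    nonempty, which strictness requires. *)
Lemma enorm_le_coord (R : realType) (I : finType) (i0 : I) (u v : {ffun I -> R}) :
  enorm u <= enorm v -> exists i, `|u i| <= `|v i|.
Proof.
move=> h; apply/not_existsP => H.
have lt i : v i ^+ 2 < u i ^+ 2.
  rewrite -(real_normK (num_real (u i))) -(real_normK (num_real (v i))).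
  by rewrite ltr_pXn2r ?nnegrE // ltNge; apply/negP/H.
have sumlt : \sum_i v i ^+ 2 < \sum_i u i ^+ 2.
  rewrite (bigD1 i0) //= [ltRHS](bigD1 i0) //=.
  by rewrite ltr_leD ?ler_sum // => i _; apply: ltW.
move: h; rewrite leNgt /enorm ltr_sqrt ?sumlt //.
by apply: le_lt_trans sumlt; apply: sumr_ge0 => i _; apply: sqr_ge0.
Qed.

(** A root would put the square of an element of Q(X_{n-1}) equal to [2 + X R n.-1], and [no_square]
    with [g = 1] would give 1 = 0. *)
Lemma ZX_sqr_neq (R : realType) (n : nat) (K : QX R n.-1) (y : K) : (0 < n)%N ->
  ZX y -> y ^+ 2 != 2 + gen K.
Proof.
case: n K y => // n K y _ /ZX_emb[f fE]; apply/eqP => /(congr1 (emb K)).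
rewrite rmorphXn rmorphD rmorph_nat emb_gen /= fE => H.
have one : (map_poly ratr 1).[X R n] = 1 :> R by rewrite rmorph1 hornerC.
have := @no_square R n false f 1; rewrite one expr1n expr0 !mul1r => /(_ H).
by apply/eqP; rewrite oner_neq0.
Qed.

Theorem theorem5p2 (R : realType) (n : nat) (hn : (1 <= n)%N) (K : QX R n.-1)
    (a : {ffun GalQ K -> R} -> K)
    (ha : forall s : {ffun GalQ K -> R}, is_sign s -> closest s (a s))
    (eps : R) (heps : RE_minus K eps)
    (hdvd1 : dvdZX K (emb K (pcoord K eps)) (emb K (qcoord K eps) - 1))
    (hdvd2 : dvdZX K (emb K (pcoord K eps)) (X R n ^+ 2 * emb K (qcoord K eps) - 1))
    (hpos : 0 < emb K (pcoord K eps) * emb K (qcoord K eps)) :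
  let s := [ffun g : GalQ K => Num.sg (gal_emb g (pcoord K eps * qcoord K eps))] in
  exists g : GalQ K, `| ln `|gal_ext g eps| | <= C_const a s g.
Proof.
move=> s; rewrite /gal_ext.
set P := pcoord K eps in hdvd1 hdvd2 hpos s *.
set Q := qcoord K eps in hdvd1 hdvd2 hpos s *.
have XE : X R n ^+ 2 = emb K (2 + gen K).
  by rewrite rmorphD rmorph_nat emb_gen -XS prednK.
(* The relations are pulled back from the reals to [K], where every automorphism can be applied to
   them. *)
have pell : P ^+ 2 - (2 + gen K) * Q ^+ 2 = -1.
  apply: (fmorph_inj (emb K)); rewrite rmorphB rmorphN1 rmorphXn rmorphM rmorphXn /= -XE.
  by case: heps.
case: hdvd2 => c Zc; rewrite XE => cE.
have {}cE : (2 + gen K) * Q - 1 = P * c.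
  by apply: (fmorph_inj (emb K)); rewrite rmorphB rmorph1 !rmorphM.
have PQ0 : P * Q != 0 by rewrite -(fmorph_eq0 (emb K)) rmorphM gt_eqF.
pose tau (g : GalQ K) : {rmorphism K -> R} := (emb K \o g)%FUN.
have tauE g : gal_emb g =1 tau g by [].
have pellg g : gal_emb g P ^+ 2 - (2 + gal_emb g (gen K)) * gal_emb g Q ^+ 2 = -1.
  by rewrite !tauE -(rmorph_nat (tau g) 2) -rmorphD -!rmorphXn -rmorphM -rmorphB pell rmorphN1.
(* Were the radicand negative, the left side of [pellg g] would be nonnegative, not -1. *)
have X2 g : gal_X g ^+ 2 = 2 + gal_emb g (gen K).
  rewrite sqr_sqrtr // leNgt; apply/negP => neg; have := pellg g.
  have := sqr_ge0 (gal_emb g P); have := sqr_ge0 (gal_emb g Q); nra.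
have ss : is_sign s.
  move=> g; rewrite ffunE tauE.
  by case: sgrP => [/eqP|_|_]; [rewrite fmorph_eq0 (negPf PQ0)|left|right].
have [Za amin] := ha s ss.
(* The identity automorphism serves only as the nonemptiness witness. *)
have [g] := enorm_le_coord _ _ 1%g _ _ (amin c Zc).
rewrite !ffunE => ag; exists g.
have X0 : 0 <= gal_X g by apply: sqrtr_ge0.
(* Were the denominator zero, [b_const] would be the junk value 0. *)
have d0 : 0 < `|s g * gal_X g - gal_emb g (a s)|.
  rewrite normr_gt0 subr_eq0; apply/eqP => /(congr1 (fun z => z ^+ 2)).
  have sg2 : s g ^+ 2 = 1 by case: (ss g) => ->; rewrite ?sqrrN expr1n.
  rewrite exprMn sg2 mul1r X2 !tauE -(rmorph_nat (tau g) 2) -rmorphD -rmorphXn.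
  by move=> /fmorph_inj/esym/eqP; apply/negP/ZX_sqr_neq.
have pb : `|gal_emb g P| <= b_const a s g.
  rewrite /b_const ler_pdivlMr // (ger0_norm (addr_ge0 X0 ler01)).
  apply: le_trans (_ : `|gal_emb g P| * `|s g * gal_X g - gal_emb g c| <= _).
    by rewrite ler_wpM2l // ffunE.
  rewrite ffunE !tauE rmorphM; apply: quotient_near_sqrt => //; rewrite X2.
    exact: pellg.
  by rewrite !tauE -(rmorph_nat (tau g) 2) -rmorphD -!rmorphM -cE rmorphB rmorph1.
(* Both sides are now values of arcsinh, so [pb] and monotonicity conclude. *)
rewrite ln_norm_unit; last by rewrite exprMn X2; have := pellg g; lra.
have b0 : 0 <= b_const a s g by apply: le_trans pb.
rewrite /C_const (ger0_norm b0) ler_ln ?posrE.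
- by apply: lerD => //; rewrite ler_wsqrtr // lerD2r -(real_normK (num_real (gal_emb g P)));
     apply: lerXn2r.
- by apply: ltr_wpDr => //; rewrite sqrtr_gt0 ltr_wpDl ?sqr_ge0.
- by apply: ltr_wpDr => //; rewrite sqrtr_gt0 ltr_wpDl ?sqr_ge0.
Qed.
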